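(* Let $k\ge 1$, let $d=\binom{k+1}{2}$, and let $M\in\mathbb{R}^{p\times q}$ be an entrywise nonnegative matrix of rank $d$. Let $M=UV$ be a rank factorization, with $U\in\mathbb{R}^{p\times d}$ and $V\in\mathbb{R}^{d\times q}$, let $u_1,\dots,u_p\in\mathbb{R}^d$ be the rows of $U$, and let $P=\mathrm{cone}(u_1,\dots,u_p)$ and $Q=\{x\in\mathbb{R}^d : x^TV\ge 0\}$. Then the psd rank of $M$ is $k$ if and only if there is an invertible linear map $\pi:\mathcal{S}^k\to\mathbb{R}^d$ such that $P\subseteq\pi(\mathcal{S}_+^k)\subseteq Q$.
   Context: $\mathcal{S}^k$ denotes the space of real symmetric $k\times k$ matrices (of dimension $\binom{k+1}{2}$) and $\mathcal{S}_+^k$ the cone of positive semidefinite matrices in it. $\mathrm{cone}(u_1,\dots,u_p)$ is the set of nonnegative linear combinations of $u_1,\dots,u_p$. The inequality $x^TV\ge0$ is entrywise. The psd rank of a nonnegative $p\times q$ matrix $M$ is the smallest $k$ such that there are $A_1,\dots,A_p,B_1,\dots,B_q\in\mathcal{S}_+^k$ with $M_{ij}=\mathrm{Trace}(A_iB_j)$ for all $i,j$. *)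

(* Defs.v *)
From HB Require Import structures.
From mathcomp Require Import all_boot all_order all_algebra.
From mathcomp Require Import classical_sets reals.
Set Implicit Arguments.
Unset Strict Implicit.
Unset Printing Implicit Defensive.
Import Order.TTheory GRing.Theory Num.Theory.
Local Open Scope ring_scope.
Local Open Scope classical_set_scope.

Section Definitions.
Context {R : realType}.

Definition asymmetry k (A : 'M[R]_k) : 'M[R]_k := A - A^T.

Fact asymmetry_is_linear k : linear (@asymmetry k).
Proof.
by move=> a A B; rewrite /asymmetry linearP opprD addrACA scalerBr.
Qed.

HB.instance Definition _ k := GRing.isLinear.Build R 'M[R]_k 'M[R]_k _
  (@asymmetry k) (@asymmetry_is_linear k).

Definition symv k : {vspace 'M[R]_k} := lker (linfun (@asymmetry k)).

Lemma mem_symv k (A : 'M[R]_k) : (A \in symv k) = (A \is symmetricmx).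
Proof.
rewrite memv_ker lfunE /= subr_eq0 qualifE /= expr0 scale1r.
by congr (_ == _); apply/matrixP=> i j; rewrite !mxE.
Qed.

Definition psdmx k (A : 'M[R]_k) : Prop :=
  A \is symmetricmx /\ forall x : 'cV[R]_k, 0 <= (x^T *m A *m x) 0 0.

Definition psd_cone k : set (subvs_of (symv k)) := [set X | psdmx (vsval X)].

Definition psd_factorization p q (M : 'M[R]_(p, q)) (k : nat) : Prop :=
  exists (A : 'I_p -> 'M[R]_k) (B : 'I_q -> 'M[R]_k),
    [/\ forall i, psdmx (A i), forall j, psdmx (B j)
      & forall i j, M i j = \tr (A i *m B j)].

(* A relation rather than a function: a matrix with a negative entry has no
   psd factorization, hence no psd rank. *)
Definition is_psd_rank p q (M : 'M[R]_(p, q)) (k : nat) : Prop :=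
  psd_factorization M k /\ forall m, psd_factorization M m -> (k <= m)%N.

Definition cone p d (u : 'I_p -> 'rV[R]_d) : set 'rV[R]_d :=
  [set x | exists2 c : 'I_p -> R,
             forall i, 0 <= c i & x = \sum_(i < p) c i *: u i].

(* Vectors of R^d are row vectors, so x^T V is written x *m V. *)
Definition ineq_cone d q (V : 'M[R]_(d, q)) : set 'rV[R]_d :=
  [set x | forall j, 0 <= (x *m V) 0 j].

End Definitions.

Arguments symv R k : clear implicits.
Arguments psd_cone R k : clear implicits.

(* Main.v *)
(** By self-duality of the psd cone, a psd factorization of M of size k is a
factorization M = A B through the space of symmetric k x k matrices in which the
rows of A are psd and the columns of B are nonnegative on the psd cone. Hence
rank M is at most C(k+1, 2), so a matrix of rank C(k+1, 2) has no psd
factorization of size less than k. When the rank equals C(k+1, 2), both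
M = A B and M = U V are rank factorizations, so U = A T and B = T V for an
invertible T, and pi is X |-> X T. *)
From HB Require Import structures.
Require Import Defs.
From mathcomp Require Import all_boot all_order all_algebra.
From mathcomp Require Import classical_sets reals.
From mathcomp Require Import ring.
Set Implicit Arguments.
Unset Strict Implicit.
Unset Printing Implicit Defensive.
Import Order.TTheory GRing.Theory Num.Theory VectorInternalTheory.
Local Open Scope ring_scope.
Local Open Scope classical_set_scope.

(** * Cauchy-Schwarz, Cholesky elimination and the trace pairing on psd matrices *)

Section PsdMatrices.
Context {R : realType} {k : nat}.
Implicit Types (X Y : 'M[R]_k) (x y : 'cV[R]_k).

Lemma symmetricmxP X : reflect (X^T = X) (X \is symmetricmx).
Proof.
by rewrite -mem_symv memv_ker lfunE /= subr_eq0 eq_sym; apply: eqP.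
Qed.

Lemma mxtrace_rank1 x X : \tr (x *m x^T *m X) = (x^T *m X *m x) 0 0.
Proof. by rewrite -mulmxA mxtrace_mulC [LHS]/mxtrace big_ord1. Qed.

Lemma quad_rank1 x y :
  (y^T *m (x *m x^T) *m y) 0 0 = (y^T *m x) 0 0 ^+ 2.
Proof.
rewrite mulmxA -mulmxA mxE big_ord1 expr2; congr (_ * _).
by rewrite -[y in x^T *m y]trmxK -trmx_mul [LHS]mxE.
Qed.

Lemma psdmx_rank1 x : psdmx (x *m x^T).
Proof.
split=> [|y]; first by apply/symmetricmxP; rewrite trmx_mul trmxK.
by rewrite quad_rank1 sqr_ge0.
Qed.

Lemma quad_sym X x y : X^T = X -> (x^T *m X *m y) 0 0 = (y^T *m X *m x) 0 0.
Proof.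
move=> symX.
have <- : (x^T *m X *m y)^T = y^T *m X *m x.
  by rewrite !trmx_mul trmxK symX mulmxA.
by rewrite [RHS]mxE.
Qed.

Lemma quad_delta X i j :
  ((delta_mx i 0 : 'cV_k)^T *m X *m (delta_mx j 0 : 'cV_k)) 0 0 = X i j.
Proof. by rewrite trmx_delta -rowE -colE !mxE. Qed.

(** The form evaluated at [x + t *: y] is a polynomial in [t] of degree at most 2 that is nowhere
    negative, so its discriminant cannot be positive. *)
Lemma psdmx_cauchy_schwarz X x y : psdmx X ->
  (x^T *m X *m y) 0 0 ^+ 2 <= (x^T *m X *m x) 0 0 * (y^T *m X *m y) 0 0.
Proof.
move=> [/symmetricmxP symX posX].
set b := (x^T *m X *m y) 0 0; set c := (x^T *m X *m x) 0 0.
set a := (y^T *m X *m y) 0 0.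
have poly t : 0 <= c + 2 * t * b + t ^+ 2 * a.
  have := posX (x + t *: y).
  rewrite [(x + _)^T]linearD /= [(t *: y)^T]linearZ /=.
  rewrite !mulmxDl !mulmxDr -!scalemxAl -!scalemxAr.
  have entry (A B C D : 'M[R]_1) :
      (A + t *: B + (t *: C + t *: (t *: D))) 0 0 =
      A 0 0 + t * B 0 0 + (t * C 0 0 + t * (t * D 0 0)) by rewrite !mxE.
  rewrite entry (quad_sym y x symX) -/c -/b -/a.
  by rewrite (_ : c + 2 * t * b + _ = c + t * b + (t * b + t * (t * a))) //; ring.
have a_ge0 : 0 <= a by apply: posX.
have [a0|a_neq0] := eqVneq a 0.
  have [->|b_neq0] := eqVneq b 0; first by rewrite a0 expr0n mulr0.
  (* With [a = 0] the polynomial is affine in [t] with slope [2 * b]; this [t] would give it the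
     value -1. *)
  have := poly (- (c + 1) / (2 * b)).
  have -> : c + 2 * (- (c + 1) / (2 * b)) * b + (- (c + 1) / (2 * b)) ^+ 2 * a
     = -1 by rewrite a0; field.
  by rewrite oppr_ge0 ler10.
have a_gt0 : 0 < a by rewrite lt_def a_neq0.
(* The minimizer of the polynomial. *)
have := poly (- b / a).
have -> : c + 2 * (- b / a) * b + (- b / a) ^+ 2 * a = (c * a - b ^+ 2) / a.
  by field.
by rewrite pmulr_lge0 ?invr_gt0 // subr_ge0.
Qed.

Lemma psdmx_diag_ge0 X i : psdmx X -> 0 <= X i i.
Proof. by case=> _ /(_ (delta_mx i 0)); rewrite quad_delta. Qed.

Lemma psdmx_diag0 X i j : psdmx X -> X i i = 0 -> X i j = 0.
Proof.
move=> psdX Xii0; apply/eqP; rewrite -sqrf_eq0 eq_le sqr_ge0 andbT.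
have := psdmx_cauchy_schwarz (delta_mx i 0) (delta_mx j 0) psdX.
by rewrite !quad_delta Xii0 mul0r.
Qed.

(* One step of Cholesky elimination with pivot [X i i]. *)
Lemma psdmx_schur X i : psdmx X -> 0 < X i i ->
  psdmx (X - (X i i)^-1 *: (col i X *m (col i X)^T)).
Proof.
move=> psdX a_gt0; have [/symmetricmxP symX posX] := psdX.
split=> [|y].
  by apply/symmetricmxP; rewrite linearB linearZ /= trmx_mul trmxK symX.
have entry (A B : 'M[R]_1) a : (A - a *: B) 0 0 = A 0 0 - a * B 0 0.
  by rewrite !mxE.
rewrite mulmxBr mulmxBl -scalemxAr -scalemxAl entry quad_rank1.
rewrite subr_ge0 mulrC ler_pdivrMr // colE mulmxA.
by have := psdmx_cauchy_schwarz y (delta_mx i 0) psdX; rewrite quad_delta.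
Qed.

(** Induction on the number of nonzero diagonal entries of [X]. Each elimination step splits off a
    nonnegative multiple of some [v *m v^T], whose trace against [Y] is a value of the quadratic
    form of [Y]. A psd matrix with zero diagonal is zero. *)
Lemma psdmx_trace_ge0 X Y : psdmx X -> psdmx Y -> 0 <= \tr (X *m Y).
Proof.
move=> psdX [symY posY].
have [n] := ubnP #|[pred i | X i i != 0]|.
elim: n X psdX => // n IHn X psdX /ltnSE le_n.
have [/existsP[i Xii_neq0]|/existsPn diag0] := boolP [exists i, X i i != 0].
  have Xii_gt0 : 0 < X i i by rewrite lt_def Xii_neq0 psdmx_diag_ge0.
  pose C := (X i i)^-1 *: (col i X *m (col i X)^T).
  rewrite -(subrK C X) mulmxDl linearD addr_ge0 //; last first.
    rewrite /C -scalemxAl linearZ /= mulr_ge0 ?mxtrace_rank1 //.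
    by rewrite invr_ge0 ltW.
  apply: IHn; first exact: psdmx_schur.
  (* The pivot entry becomes 0, and a diagonal entry that is already 0 stays so because its whole
     row vanishes. *)
  apply: leq_trans le_n; apply: proper_card; apply/properP; split; last first.
    exists i; rewrite !inE // !mxE big_ord1 !mxE negbK.
    by rewrite mulKf // subrr.
  apply/fintype.subsetP => j; rewrite !inE; apply: contraNneq => Xjj0.
  by rewrite !mxE big_ord1 !mxE Xjj0 (psdmx_diag0 _ psdX Xjj0) mul0r mulr0 subrr.
suff -> : X = 0 by rewrite mul0mx linear0.
by apply/matrixP=> i j; rewrite mxE psdmx_diag0 //; apply/eqP/negPn.
Qed.

End PsdMatrices.

(** * The dimension of the space of symmetric matrices *)

Section SymmetricMatrices.
Context {R : realType} {k : nat}.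

Lemma symv_sym (X : subvs_of (symv R k)) : (vsval X)^T = vsval X.
Proof. by apply/symmetricmxP; rewrite -mem_symv subvsP. Qed.

Let upper := {ij : 'I_k * 'I_k | (ij.1 <= ij.2)%N}.

Lemma card_upper : #|{: upper}| = 'C(k.+1, 2).
Proof.
rewrite card_sig -sum1_card big_mkcond /=.
rewrite -(pair_bigA _ (fun i j : 'I_k => if (i <= j)%N then 1%N else 0%N)) /=.
(* Column [j] contains [j + 1] indices; dropping the zero term of the sum 0 + ... + k gives the same
   shift. *)
rewrite exchange_big /= -bin2_sum big_nat_recl // add0n big_mkord.
apply: eq_bigr => j _; rewrite -big_mkcond /=.
by rewrite -(big_ord_widen k (fun=> 1%N) (ltn_ord j)) sum1_card card_ord.
Qed.

Definition upper_part (X : subvs_of (symv R k)) : {ffun upper -> R^o} :=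
  [ffun ij => vsval X (val ij).1 (val ij).2].

Fact upper_part_is_linear : linear upper_part.
Proof. by move=> a X Y; apply/ffunP=> ij; rewrite !ffunE linearP !mxE. Qed.

HB.instance Definition _ := GRing.isLinear.Build R (subvs_of (symv R k))
  {ffun upper -> R^o} _ upper_part upper_part_is_linear.

Lemma upper_part_inj : injective upper_part.
Proof.
move=> X Y /ffunP eqXY; apply: val_inj; apply/matrixP.
have eq_up (i j : 'I_k) : (i <= j)%N -> vsval X i j = vsval Y i j.
  by move=> ij; have := eqXY (exist _ (i, j) ij); rewrite !ffunE.
have symS (Z : subvs_of (symv R k)) i j : vsval Z i j = vsval Z j i.
  by rewrite -[in LHS]symv_sym mxE.
move=> i j; have [/eq_up//|/ltnW/eq_up] := leqP i j.
by rewrite symS => ->; rewrite symS.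
Qed.

Lemma upper_part_surj f : exists X, upper_part X = f.
Proof.
(* The symmetric extension of [f]. The default 0 is never reached, since [i <= j] or [j <= i]; if
   both hold, the two branches agree. *)
pose A : 'M[R]_k := \matrix_(i, j)
  if insub (i, j) is Some ij then f ij
  else if insub (j, i) is Some ij then f ij else 0.
have symA : A \in symv R k.
  rewrite mem_symv; apply/symmetricmxP/matrixP => i j; rewrite !mxE.
  case: insubP => [u /= ij u1|]; case: insubP => [v /= ji v1|] //=.
  have /val_inj e : i = j :> nat by apply/eqP; rewrite eqn_leq ij ji.
  by congr (f _); apply: val_inj; rewrite [LHS]u1 [RHS]v1 e.
exists (vsproj _ A); apply/ffunP=> ij; rewrite ffunE vsprojK // mxE.
by rewrite -surjective_pairing valK.
Qed.

Lemma dim_symv : \dim (symv R k) = 'C(k.+1, 2).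
Proof.
have ker0 : lker (linfun upper_part) == 0%VS.
  by apply/lker0P => X Y; rewrite !lfunE; apply: upper_part_inj.
have img : limg (linfun upper_part) = fullv.
  apply/vspaceP=> f; rewrite memvf; have [X <-] := upper_part_surj f.
  by rewrite -(lfunE upper_part) memv_img ?memvf.
have := limg_dim_eq (f := linfun upper_part) (U := fullv).
rewrite (eqP ker0) capv0 img !dimvf => /(_ erefl) dimE.
by rewrite -card_upper -[RHS]muln1; exact: esym dimE.
Qed.

End SymmetricMatrices.

(** * Trace duality, and psd factorizations as matrix factorizations *)

Section TraceForm.
Context {R : realType}.
Local Notation sym k := (subvs_of (symv R k)).

Definition trace_row k q (B : 'I_q -> 'M[R]_k) (X : sym k) : 'rV[R]_q :=
  \row_j \tr (vsval X *m B j).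

Fact trace_row_is_linear k q (B : 'I_q -> 'M[R]_k) : linear (trace_row B).
Proof.
move=> a X Y; apply/rowP=> j.
by rewrite !mxE linearP mulmxDl -scalemxAl linearP.
Qed.

HB.instance Definition _ k q B := GRing.isLinear.Build R (sym k) 'rV[R]_q _
  (trace_row B) (@trace_row_is_linear k q B).

(** Riesz representation for the trace form: the symmetrized matrix units [S a b] span, so [h] is
    determined by its values on them, and these values are the entries of the representing
    matrices. *)
Lemma trace_row_riesz k q (h : {linear sym k -> 'rV[R]_q}) :
  exists2 B : 'I_q -> 'M[R]_k, forall j, (B j)^T = B j & h =1 trace_row B.
Proof.
pose S a b : 'M[R]_k := 2^-1 *: (delta_mx a b + delta_mx b a).
have SC a b : S a b = S b a by rewrite /S addrC.
have symS a b : S a b \in symv R k.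
  rewrite mem_symv; apply/symmetricmxP; rewrite linearZ linearD /=.
  by rewrite !trmx_delta addrC.
have decomp (X : sym k) :
    X = \sum_a \sum_b vsval X a b *: vsproj (symv R k) (S a b).
  have term a b : vsval (vsval X a b *: vsproj (symv R k) (S a b)) =
      2^-1 *: (vsval X a b *: delta_mx a b + vsval X b a *: delta_mx b a).
    rewrite linearZ /= vsprojK // -[in vsval X b a]symv_sym mxE -scalerDr.
    by rewrite !scalerA mulrC.
  apply: val_inj; rewrite linear_sum /=.
  (* Summing over all ordered pairs counts [X] twice, once through its transpose; the factor 1/2 in
     [S] compensates. *)
  transitivity (2^-1 *: (\sum_a \sum_b vsval X a b *: delta_mx a b +
                         \sum_a \sum_b vsval X b a *: delta_mx b a)).
    rewrite [X in _ + X]exchange_big /= -matrix_sum_delta -mulr2n -scaler_nat.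
    by rewrite scalerA mulVf ?scale1r ?pnatr_eq0.
  rewrite -big_split scaler_sumr; apply: eq_bigr => a _.
  rewrite -big_split scaler_sumr linear_sum; apply: eq_bigr => b _.
  by rewrite [RHS]term.
exists (fun j => \matrix_(a, b) h (vsproj _ (S a b)) 0 j) => [j|X].
  by apply/matrixP=> a b; rewrite !mxE SC.
apply/rowP=> j; rewrite mxE {1}(decomp X) linear_sum summxE /mxtrace.
apply: eq_bigr => a _; rewrite linear_sum summxE mxE.
by apply: eq_bigr => b _; rewrite linearZ !mxE SC.
Qed.

(** The two directions are the two halves of self-duality: traces of products of psd matrices are
    nonnegative, and a symmetric matrix with nonnegative trace against every [x *m x^T] is psd.
    Coordinates [v2r] make rank arguments available. *)
Lemma psd_factorizationP p q (M : 'M[R]_(p, q)) k :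
  psd_factorization M k <->
  exists A : 'M[R]_(p, dim (sym k)), exists B : 'M[R]_(dim (sym k), q),
    [/\ M = A *m B, forall i, psd_cone R k (r2v (row i A))
      & forall X, psd_cone R k X -> ineq_cone B (v2r X)].
Proof.
split=> [[A [B [psdA psdB Mtr]]]|[A [B [-> psdA dualB]]]].
  have rB X : v2r X *m lin1_mx (trace_row B \o r2v) = trace_row B X.
    by rewrite mul_rV_lin1 /= v2rK.
  have AK i : vsval (vsproj (symv R k) (A i)) = A i.
    by rewrite vsprojK // mem_symv; case: (psdA i).
  exists (\matrix_i v2r (vsproj (symv R k) (A i))).
  exists (lin1_mx (trace_row B \o r2v)); split=> [|i|X psdX j].
  - by apply/row_matrixP=> i; apply/rowP=> j; rewrite row_mul rowK rB !mxE AK Mtr.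
  - by rewrite rowK v2rK /psd_cone /= AK.
  - by rewrite rB mxE; apply: psdmx_trace_ge0.
have [C symC hC] := trace_row_riesz (mulmxr B \o v2r).
exists (fun i => vsval (r2v (row i A))), C; split=> // [j|i j].
  split=> [|x]; first exact/symmetricmxP.
  have xK : vsval (vsproj (symv R k) (x *m x^T)) = x *m x^T.
    by rewrite vsprojK // mem_symv; case: (psdmx_rank1 x).
  rewrite -mxtrace_rank1 -xK.
  have /dualB /(_ j) : psd_cone R k (vsproj _ (x *m x^T)).
    by rewrite /psd_cone /= xK; apply: psdmx_rank1.
  by have /= -> := hC (vsproj _ (x *m x^T)); rewrite mxE.
have /= := hC (r2v (row i A)); rewrite r2vK -row_mul.
by move=> /rowP /(_ j); rewrite !mxE.
Qed.

Lemma psd_factorization_rank p q (M : 'M[R]_(p, q)) k :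
  psd_factorization M k -> (\rank M <= 'C(k.+1, 2))%N.
Proof.
case/psd_factorizationP=> A [B [-> _ _]].
by rewrite (leq_trans (mulmx_max_rank _ _)) // -(@dim_symv R).
Qed.

End TraceForm.

(** * Psd factorizations versus linear images of the psd cone *)

Theorem proposition4p4 (R : realType) (k d p q : nat)
    (hk : (1 <= k)%N) (hd : d = 'C(k.+1, 2))
    (M : 'M[R]_(p, q)) (hM : forall i j, 0 <= M i j) (hrank : \rank M = d)
    (U : 'M[R]_(p, d)) (V : 'M[R]_(d, q)) (hUV : M = U *m V) :
  is_psd_rank M k <->
  exists pi : 'Hom(subvs_of (symv R k), 'rV[R]_d),
    [/\ bijective pi,
        cone (fun i => row i U) `<=` pi @` psd_cone R k
      & pi @` psd_cone R k `<=` ineq_cone V].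
Proof.
have dimk : dim (subvs_of (symv R k)) = d by rewrite hd -(@dim_symv R).
split=> [[/psd_factorizationP[A [B [MAB psdA dualB]]] _]|[pi [[g piK gK] P Q]]].
  have fullA : row_full A.
    by rewrite -col_leq_rank (leq_trans _ (mxrankM_maxl A B)) // -MAB hrank dimk.
  have freeV : row_free V.
    by rewrite -row_leq_rank -[leqLHS]hrank hUV mxrankM_maxr.
  (* The change of basis between the two rank factorizations: [V] has a right inverse, and [A] a
     left one. *)
  pose T := B *m pinvmx V.
  have AT : A *m T = U by rewrite mulmxA -MAB hUV -mulmxA mulmxVp ?mulmx1.
  have TV : T *m V = B.
    rewrite -[LHS]mul1mx -(mulVpmx fullA) -mulmxA [A *m _]mulmxA AT -hUV MAB.
    by rewrite mulmxA mulVpmx ?mul1mx.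
  (* [M = A *m T *m V] has rank [d], so its middle factor has rank at least [d]. *)
  have rankT : \rank T = d.
    apply/eqP; rewrite eqn_leq rank_leq_col -[leqLHS]hrank hUV -AT.
    by rewrite (leq_trans (mxrankM_maxl _ _)) ?mxrankM_maxr.
  have freeT : row_free T by rewrite /row_free rankT dimk.
  have fullT : row_full T by rewrite /row_full rankT.
  pose pi := linfun (mulmxr T \o v2r : subvs_of (symv R k) -> 'rV[R]_d).
  have piE X : pi X = v2r X *m T by rewrite lfunE.
  exists pi; split.
  - exists (fun y => r2v (y *m pinvmx T)) => [X|y].
      by rewrite piE -mulmxA mulmxVp // mulmx1 v2rK.
    by rewrite piE r2vK -mulmxA mulVpmx // mulmx1.
  (* As [pi] sends row [i] of [A] to row [i] of [U], the same coefficients give a psd preimage. *)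
  - move=> _ [c c_ge0 ->]; exists (\sum_i c i *: r2v (row i A)).
      split=> [|x]; first by rewrite -mem_symv subvsP.
      rewrite linear_sum mulmx_sumr mulmx_suml summxE; apply: sumr_ge0 => i _.
      rewrite linearZ /= -scalemxAl mxE mulr_ge0 //.
      by case: (psdA i) => _; apply.
    rewrite linear_sum; apply: eq_bigr => i _.
    by rewrite linearZ /= piE r2vK -row_mul AT.
  - by move=> _ [X psdX <-] j; rewrite piE -mulmxA TV; apply: dualB.
split=> [|m /psd_factorization_rank]; last first.
  (* If [m < k], then C(m+1, 2) <= C(k, 2) < C(k, 2) + k = C(k+1, 2); strictness uses [hk]. *)
  rewrite hrank hd; apply: contraTT; rewrite -!ltnNge => lt_mk.
  rewrite (leq_ltn_trans (leq_bin2l 2 lt_mk)) // binS bin1.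
  by rewrite -[ltnLHS]addn0 ltn_add2l.
have piE X : v2r X *m lin1_mx (pi \o r2v) = pi X by rewrite mul_rV_lin1 /= v2rK.
(* Insert the inverse [g] of [pi] followed by [pi] between [U] and [V]. *)
apply/psd_factorizationP; exists (\matrix_i v2r (g (row i U))).
exists (lin1_mx (pi \o r2v) *m V); split=> [|i|X psdX].
- by apply/row_matrixP=> i; rewrite hUV !row_mul mulmxA rowK piE gK.
(* Each row of [U] lies in its own cone, so it has a psd preimage, which must be its image under
   [g]. *)
- rewrite rowK v2rK; have [|X psdX <-] := P (row i U); last by rewrite piK.
  exists (fun j => (i == j)%:R) => [j|]; first exact: ler0n.
  by rewrite (bigD1 i) //= eqxx scale1r big1 ?addr0 // => j /negPf;
    rewrite eq_sym => ->; rewrite scale0r.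
- move=> j; rewrite mulmxA piE.
  by apply: Q; exists X.
Qed.
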